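(* If $\mathcal{U}$ is a Laver ultrafilter, then $\mathcal{U}$ is hereditarily rapid, i.e., if $\mathcal{V}$ is an ultrafilter over $\omega$ such that $\mathcal{V}\le_{\mathrm{RK}}\mathcal{U}$, then $\mathcal{V}$ is rapid.
   Context: By an ultrafilter we always mean a non-principal ultrafilter. Laver ultrafilter: an ultrafilter $\mathcal{U}$ over $\omega$ is a Laver ultrafilter if for every sequence $\langle \mathcal{P}_n : n\in\omega\rangle$, where each $\mathcal{P}_n$ is a partition of $\omega$ into finitely many sets, there exists $x\in\mathcal{U}$ such that for all $n\in\omega$, $x$ has non-empty intersection with at most $n+1$ elements of $\mathcal{P}_n$. Rudin-Keisler order: $\mathcal{V}\le_{\mathrm{RK}}\mathcal{U}$ if there is $f\in\omega^\omega$ such that $f^{-1}(x)\in\mathcal{U}$ for all $x\in\mathcal{V}$. Rapid: an ultrafilter $\mathcal{V}$ over $\omega$ is rapid if for every strictly increasing $f\in\omega^\omega$ there is $x\in\mathcal{V}$ with $|x\cap f(n)|\le n$ for all $n\in\omega$ (where $f(n)=\{0,\dots,f(n)-1\}$). *)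

(* Defs.v *)
From mathcomp Require Import all_boot.
From mathcomp Require Import boolp classical_sets functions cardinality filter.

Set Implicit Arguments.
Unset Strict Implicit.
Unset Printing Implicit Defensive.

Local Open Scope classical_set_scope.
Local Open Scope card_scope.

Definition nonprincipal_ultrafilter (U : set_system nat) : Prop :=
  UltraFilter U /\ forall n : nat, U <> principal_filter n.

(* The blocks of a finite partition of nat form a set of sets indexed by
   itself; the library's partition predicate requires nonempty blocks. *)
Definition finite_partition (P : set (set nat)) : Prop :=
  finite_set P /\ partition P id [set: nat].

Definition laver_ultrafilter (U : set_system nat) : Prop :=
  nonprincipal_ultrafilter U /\
  forall P : nat -> set (set nat), (forall n, finite_partition (P n)) ->
  exists x : set nat, U x /\
    forall n, [set A | P n A /\ x `&` A !=set0] #<= `I_n.+1.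

Definition rk_le (V U : set_system nat) : Prop :=
  exists f : nat -> nat, forall x : set nat, V x -> U (f @^-1` x).

Definition rapid (V : set_system nat) : Prop :=
  forall f : nat -> nat, {homo f : m n / (m < n)%N} ->
  exists x : set nat, V x /\ forall n, x `&` `I_(f n) #<= `I_n.

Definition hereditarily_rapid (U : set_system nat) : Prop :=
  forall V : set_system nat,
    nonprincipal_ultrafilter V -> rk_le V U -> rapid V.

(* Main.v *)
Require Import Defs.
From mathcomp Require Import all_boot.
From mathcomp Require Import boolp classical_sets functions cardinality filter.

(** Let [g] witness [V <= U] in the Rudin-Keisler order and let [f] be strictly
    increasing.  The map [k |-> minn (g k) m] has finite range, so its fibers
    form a finite partition of [nat], in which the fiber over a value [j < m]
    is exactly [g @^-1` [set j]].  Taking [m = f n.+1] in the [n]-th partition,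
    the Laver property yields [x] in [U] meeting at most [n.+1] fibers, so that
    its image [g @` x] has at most [n.+1] elements below [f n.+1].  The
    image lies in [V] because [V] is maximal ([image_mem_ultra]).

    The Laver bound is [n.+1] where rapidity asks for [n]; this is the reason
    for the shift from [f n] to [f n.+1].  The shift leaves out only the
    requirement that the set have no element below [f 0], which is met by
    removing an initial segment: a nonprincipal ultrafilter contains all final
    segments ([nonprincipal_final_segment]). *)

Local Open Scope classical_set_scope.
Local Open Scope card_scope.

(** The empty fibers have to be left out, hence the indexing by the range. *)
Definition fibers {T T' : Type} (h : T -> T') : set (set T) :=
  [set h @^-1` [set j] | j in range h].

Lemma finite_partition_fibers (h : nat -> nat) :
  finite_set (range h) -> finite_partition (fibers h).
Proof.
move=> finh; split; first exact: finite_image.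
split.
- rewrite -subTset => k _; exists (h @^-1` [set h k]) => //.
  by exists (h k) => //; exists k.
- by move=> _ _ [i _ <-] [j _ <-] [k [/= <- <-]].
- by move=> _ [_ [k _ <-] <-]; exists k.
Qed.

Lemma finite_range_minn (g : nat -> nat) (m : nat) :
  finite_set (range (fun k => minn (g k) m)).
Proof.
apply: sub_finite_set (finite_II m.+1) => _ [k _ <-] /=.
by rewrite ltnS geq_minr.
Qed.

(** Distinct points of the image below [m] have distinct, hence disjoint,
    fibers under the truncation of [g], and each of these meets [x]. *)
Lemma card_image_le_fibers (g : nat -> nat) (m : nat) (x : set nat) :
  (g @` x) `&` `I_m #<=
    [set A | fibers (fun k => minn (g k) m) A /\ x `&` A !=set0].
Proof.
set h := fun k => minn (g k) m.
have hE k : (g k < m)%N -> h k = g k by move=> /ltnW/minn_idPl.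
have injF : {in (g @` x) `&` `I_m &, injective (fun j => h @^-1` [set j])}.
  move=> i j; rewrite !inE => -[[k xk <-] /= km] _ eqF.
  have : (h @^-1` [set g k]) k by exact: hE.
  by rewrite eqF /= hE.
rewrite -(card_le_eql (inj_card_eq injF)).
apply: subset_card_le => _ [_ [[k xk <-] /= km] <-].
split; first by exists (g k) => //; exists k => //; exact: hE.
by exists k; split => //; exact: hE.
Qed.

(** Otherwise the complement of [g @` x] is in [V], and its preimage is a
    member of [U] disjoint from [x]. *)
Lemma image_mem_ultra (T T' : Type) (U : set_system T) (V : set_system T')
    (g : T -> T') (x : set T) :
  ProperFilter U -> UltraFilter V ->
  (forall y, V y -> U (g @^-1` y)) -> U x -> V (g @` x).
Proof.
move=> UF VF gVU Ux; have [//|/gVU UC] := in_ultra_setVsetC (g @` x) VF.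
have [k [xk]] := filter_ex (filterI Ux UC).
by case; exists k.
Qed.

(** By maximality, an ultrafilter containing a singleton is the principal
    filter at that point; so all complements of points, and with them all
    cofinite sets, are members. *)
Lemma nonprincipal_final_segment (V : set_system nat) (n : nat) :
  nonprincipal_ultrafilter V -> V (~` `I_n).
Proof.
move=> [VF npV]; elim: n => [|n IHn].
  by rewrite II0 setC0; exact: filterT.
have [Vn|VCn] := in_ultra_setVsetC [set n] VF.
  case: (npV n); apply: (@max_filter _ _ (principal_filter_ultra n)).
  move=> A /principal_filterP An.
  by apply: filterS Vn => _ ->.
apply: filterS (filterI IHn VCn) => k [/= kn kNn].
by rewrite ltnS leq_eqVlt => /orP[/eqP|].
Qed.

Theorem proposition3p2 (U : set_system nat) :
  laver_ultrafilter U -> hereditarily_rapid U.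
Proof.
move=> [[UF _] laverU] V npV [g gVU] f _.
have [VF _] := npV.
have [x [Ux xP]] := laverU (fun n => fibers (fun k => minn (g k) (f n.+1)))
  (fun n => finite_partition_fibers _ (finite_range_minn g (f n.+1))).
exists ((g @` x) `&` ~` `I_(f 0)); split.
  apply: filterI; last exact: nonprincipal_final_segment.
  exact: image_mem_ultra gVU Ux.
case=> [|n]; first by rewrite -setIA setICl setI0; exact: card_ge0.
apply: card_le_trans (xP n); apply: card_le_trans (card_image_le_fibers _ _ _).
by apply: subset_card_le => j [[]].
Qed.
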